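(* Let $A=\{a_k\}_{k\in\mathbb{Z}}$ and $B=\{b_k\}_{k\in\mathbb{Z}}$ be sequences of complex numbers, each being $o(k^{c})$ as $k\to\pm\infty$ for some $c<1$. Let $x$ and $y$ be nonzero real numbers with $x\notin\mathbb{Z}$. Then $$\begin{aligned} &\pi^2xy\cot(\pi x;A)\coth(\pi y;B)\\ &=a_0b_0+2a_0D^{(B)}(2)y^2-2b_0D^{(A)}(2)x^2\\ &\quad-2\pi xy\sum_{n=1}^\infty\left\{\frac{x^2a_n\coth(\pi ny/x;B)}{n(n^2-x^2)}+\frac{y^2b_n\coth(\pi nx/y;A)}{n(n^2+y^2)}\right\}. \end{aligned}$$
   Context: Growth conditions $a_k=o(k^c)$ are understood with $|k|^c$ for negative $k$. For a sequence $A=\{a_k\}$ (likewise $B=\{b_k\}$): $D^{(A)}(j):=\sum_{k=1}^\infty\frac{a_k}{k^j}$ for $j>1$. The cotangent function with sequence $A$ is defined by $$\pi\cot(\pi s;A):=\frac{a_0}{s}-2s\sum_{k=1}^\infty\frac{a_k}{k^2-s^2},$$ and the hyperbolic cotangent with sequence $A$ by $\coth(s;A):=i\cot(is;A)$. *)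

(* Defs.v *)
From HB Require Import structures.
From mathcomp Require Import all_boot all_order all_algebra.
From mathcomp Require Import complex.
From mathcomp Require Import all_classical all_reals all_analysis.

Set Implicit Arguments.
Unset Strict Implicit.
Unset Printing Implicit Defensive.

Import Order.TTheory GRing.Theory Num.Theory.
Import numFieldNormedType.Exports.

Local Open Scope classical_set_scope.
Local Open Scope ring_scope.
Local Open Scope complex_scope.

(* The cast to [R[i]^o] selects the usual (norm) topology on [R[i]]. *)
Definition psum1 (R : realType) (u : nat -> R[i]) : nat -> R[i]^o :=
  fun n => \sum_(1 <= k < n.+1) u k.

(* As with every [limn], the value is meaningful only when [psum1 u]
   converges. *)
Definition sum1 (R : realType) (u : nat -> R[i]) : R[i] := limn (psum1 u).

(* a_k = o(|k|^c) as k -> +oo and as k -> -oo. *)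
Definition littleo_pow (R : realType) (A : int -> R[i]) (c : R) : Prop :=
  (fun n : nat => A n%:Z : R[i]^o) =o_\oo
    (fun n : nat => (n%:R `^ c)%:C : R[i]^o) /\
  (fun n : nat => A (- n%:Z) : R[i]^o) =o_\oo
    (fun n : nat => (n%:R `^ c)%:C : R[i]^o).

Definition Dseq (R : realType) (A : int -> R[i]) (j : nat) : R[i] :=
  sum1 (fun k => A k%:Z / k%:R ^+ j).

(* [picot A s] is pi cot(pi s; A). *)
Definition picot (R : realType) (A : int -> R[i]) (s : R[i]) : R[i] :=
  A 0 / s - 2 * s * sum1 (fun k => A k%:Z / (k%:R ^+ 2 - s ^+ 2)).

Definition cot_seq (R : realType) (A : int -> R[i]) (z : R[i]) : R[i] :=
  picot A (z / (pi : R)%:C) / (pi : R)%:C.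

Definition coth_seq (R : realType) (A : int -> R[i]) (s : R[i]) : R[i] :=
  'i%C * cot_seq A ('i%C * s).

(* Main.v *)
Require Import Defs.
From HB Require Import structures.
From mathcomp Require Import all_boot all_order all_algebra.
From mathcomp Require Import complex ring lra.
From mathcomp Require Import all_classical all_reals all_analysis.

Set Implicit Arguments.
Unset Strict Implicit.
Unset Printing Implicit Defensive.

Import Order.TTheory GRing.Theory Num.Theory.
Import numFieldNormedType.Exports.

Local Open Scope classical_set_scope.
Local Open Scope ring_scope.
Local Open Scope complex_scope.

(** Write [t = n^2 - x^2], [s = m^2 + y^2].  The identity
    [1/t * 1/(m^2 + (n y/x)^2) + 1/s * 1/(n^2 + (m x/y)^2) = 1/t * 1/s]
    multiplied by [a_n b_m], splits each term of the product of the series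
    [sum a_n/t] and [sum b_m/s] as [F n m + G n m].  Since [|a_n| / n^2] and [|b_m| / m^2] are
    summable, [F] and [G] are dominated by products of summable sequences, so
    completing the [N x N] square of terms to full rows of [F] and full columns
    of [G] costs only the tails of convergent series; hence the series of
    (n-th row of [F]) + (n-th column of [G]) converges to the product.  The
    remaining terms come from [x^2/(n^2 (n^2 - x^2)) = 1/(n^2 - x^2) - 1/n^2] and
    its analogue for [y]. *)

(* Stated over an abstract field: on the concrete [R[i]^o] unification with
   [cvgM], [cvgD] is intractable. *)
Section RegularCvg.
Context {K : numFieldType}.
Implicit Types (f g : nat -> K^o) (a b : K^o).

Lemma cvgn_regM f g a b : f @ \oo --> a -> g @ \oo --> b ->
  (fun n => (f n : K) * (g n : K) : K^o) @ \oo --> ((a : K) * (b : K) : K^o).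
Proof. by move=> fa gb; exact: cvgM. Qed.

Lemma cvgn_regseriesZ (c : K) f a : series f @ \oo --> a ->
  series (fun n => c * (f n : K) : K^o) @ \oo --> (c * (a : K) : K^o).
Proof.
move=> fa; rewrite (_ : series _ = (fun n => c * (series f n : K))).
  exact: cvgMl_tmp.
by apply/funext => n; rewrite /series /= mulr_sumr.
Qed.

Lemma cvgn_regseriesD f g a b : series f @ \oo --> a -> series g @ \oo --> b ->
  series (fun n => (f n : K) + (g n : K) : K^o) @ \oo --> ((a : K) + (b : K) : K^o).
Proof.
move=> fa gb; rewrite (_ : series _ = series f \+ series g); first exact: cvgD.
by apply/funext => n; rewrite /series /= big_split.
Qed.

Lemma cvgn_regseriesB f g a b : series f @ \oo --> a -> series g @ \oo --> b ->
  series (fun n => (f n : K) - (g n : K) : K^o) @ \oo --> ((a : K) - (b : K) : K^o).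
Proof.
move=> fa gb; rewrite (_ : series _ = series f \- series g); first exact: cvgB.
by apply/funext => n; rewrite /series /= sumrB.
Qed.

Lemma cvgn_reglim f a : f @ \oo --> a -> limn f = a.
Proof. by move=> fa; apply: cvg_lim fa; exact: norm_hausdorff. Qed.

End RegularCvg.

(** * Complex series: comparison with real series and row-column summation *)

Section ComplexSeries.
Context {R : realType}.
Local Notation Re := (@complex.Re R).
Local Notation Im := (@complex.Im R).
Implicit Types (u f g : nat -> R[i]^o) (v : nat -> R).

Lemma normc_real (r : R) : `|r%:C| = `|r|%:C.
Proof. by rewrite normc_def /= expr0n addr0 sqrtr_sqr. Qed.

Lemma cvgn_close f g (e : nat -> R) (l : R[i]^o) :
  (forall n, `|f n - g n| <= (e n)%:C) -> e @ \oo --> (0 : R) ->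
  g @ \oo --> l -> f @ \oo --> l.
Proof.
move=> fg /cvgrPdist_le e0 /cvgrPdist_le gl; apply/cvgrPdist_le => eps.
(* A positive element of [R[i]] has zero imaginary part, so [eps] is a real number. *)
rewrite ltcE => /= /andP[/eqP im0 re0].
have -> : eps = (Re eps)%:C by case: eps im0 re0 => a b /= ->.
have re2 : 0 < Re eps / 2 by rewrite divr_gt0.
have re2C : 0 < (Re eps / 2)%:C :> R[i] by rewrite ltcR.
apply: filterS2 (e0 _ re2) (gl _ re2C) => n.
rewrite sub0r normrN => en lg.
rewrite -(subrKA (g n)) (le_trans (ler_normD _ _)) //.
rewrite [Re eps]splitr rmorphD lerD // distrC (le_trans (fg n)) // lecR.
exact: le_trans (ler_norm _) en.
Qed.

Lemma cvgn_complex f (a b : R) :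
  Re \o f @ \oo --> a -> Im \o f @ \oo --> b -> f @ \oo --> (a +i* b : R[i]^o).
Proof.
move=> fa fb.
apply: (@cvgn_close _ (cst (a +i* b)) (fun n => `|Re (f n) - a| + `|Im (f n) - b|)).
- move=> n.
  have -> : f n - cst (a +i* b) n
      = (Re (f n) - a)%:C + 'i%C * (Im (f n) - b)%:C :> R[i].
    by rewrite [LHS]complexE /=; case: (f n).
  rewrite (le_trans (ler_normD _ _))// normrM !normc_real.
  by rewrite normc_def /= expr0n expr1n add0r sqrtr1 mul1r -rmorphD.
- rewrite -[0]addr0; apply: cvgD; apply/norm_cvg0P.
  + by rewrite -(subrr a); apply: cvgB => //; exact: cvg_cst.
  + by rewrite -(subrr b); apply: cvgB => //; exact: cvg_cst.
- exact: cvg_cst.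
Qed.

(** Comparison is applied to real and imaginary parts separately. The explicit remainder bound is
    what [cvgn_diag_series] uses. *)
Lemma series_dominated u v : (forall k, `|u k| <= (v k)%:C) -> cvgn (series v) ->
  cvgn (series u) /\
  forall n, `|limn (series u) - series u n| <= (limn (series v) - series v n)%:C.
Proof.
move=> uv cv.
have v0 k : 0 <= v k by rewrite -ler0c; exact: le_trans (uv k).
have cRe : cvgn (series (Re \o u)).
  apply: normed_cvg; apply: (series_le_cvg _ v0) cv => k //=.
  by rewrite -lecR; apply: le_trans (uv k); exact: normc_ge_Re.
have cIm : cvgn (series (Im \o u)).
  apply: normed_cvg; apply: (series_le_cvg _ v0) cv => k //=.
  (* [- Im z] is the real part of [z * 'i], and ['i] has norm 1. *)
  rewrite -lecR; apply: le_trans (uv k); rewrite -normrN -ReiNIm.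
  apply: le_trans (normc_ge_Re _) _.
  by rewrite normrM [`|'i%C|]normc_def /= expr0n expr1n add0r sqrtr1 mulr1.
have ReE n : Re (series u n) = series (Re \o u) n.
  by apply: (big_morph Re) => // -[a b] [c d].
have ImE n : Im (series u n) = series (Im \o u) n.
  by apply: (big_morph Im) => // -[a b] [c d].
have cu : cvgn (series u).
  apply/cvg_ex; exists (limn (series (Re \o u)) +i* limn (series (Im \o u))).
  apply: cvgn_complex.
  - by rewrite (_ : _ \o _ = series (Re \o u)) //; apply/funext => n; exact: ReE.
  - by rewrite (_ : _ \o _ = series (Im \o u)) //; apply/funext => n; exact: ImE.
split=> // n.
set l := limn (series u); set V := limn (series v).
have tail m : (n <= m)%N -> `|series u m - series u n| <= (V - series v n)%:C.
  move=> nm; rewrite /= sub_series_geq //.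
  apply: le_trans (ler_norm_sum _ _ _) _.
  apply: (@le_trans _ _ (\sum_(n <= k < m) v k)%:C).
    by rewrite rmorph_sum; apply: ler_sum.
  rewrite lecR -sub_series_geq // lerD2r.
  apply: nondecreasing_cvgn_le => //.
  exact: nondecreasing_series.
(* The block bound [tail] passes to the limit with slack [e], using an index beyond both [n] and the
   threshold for [e]. *)
have : forall e : R, 0 < e -> `|l - series u n| <= (V - series v n + e)%:C.
  move=> e e0.
  have e0' : 0 < e%:C :> R[i] by rewrite ltcR.
  have /cvgrPdist_le/(_ _ e0') [N _ HN] := cu.
  have := HN (maxn N n) (leq_maxl _ _) => /= lN.
  rewrite -(subrKA (series u (maxn N n))) (le_trans (ler_normD _ _))//.
  by rewrite rmorphD addrC lerD// tail// leq_maxr.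
have -> : `|l - series u n| = (Re `|l - series u n|)%:C by rewrite normc_def.
by move=> H; rewrite lecR; apply/ler_addgt0Pr => e /H; rewrite lecR.
Qed.

(** After [N] terms, the distance to the product of the partial sums of [a] and [b] is at most
    (partial sum of [p]) times (remainder of [q]) plus (partial sum of [q']) times (remainder of
    [p']). Each product has a convergent factor and a null one. *)
Lemma cvgn_diag_series (F G : nat -> nat -> R[i]) (a b : nat -> R[i])
    (p q p' q' : nat -> R) :
  (forall n m, F n m + G n m = a n * b m) ->
  (forall n m, `|F n m| <= (p n * q m)%:C) ->
  (forall n m, `|G n m| <= (p' n * q' m)%:C) ->
  (forall n, 0 <= p n) -> (forall n, 0 <= q' n) ->
  cvgn (series p) -> cvgn (series q) -> cvgn (series p') -> cvgn (series q') ->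
  cvgn (series (a : nat -> R[i]^o)) -> cvgn (series (b : nat -> R[i]^o)) ->
  series (fun n => limn (series (F n : nat -> R[i]^o))
               + limn (series (G ^~ n : nat -> R[i]^o))) @ \oo -->
  ((limn (series (a : nat -> R[i]^o)) : R[i])
   * (limn (series (b : nat -> R[i]^o)) : R[i]) : R[i]^o).
Proof.
move=> FG Fb Gb p0 q0 cp cq cp' cq' ca cb.
have seriesZ (v : nat -> R) c : cvgn (series v) ->
    series (fun k => c * v k) = (fun n => c * series v n) /\
    series (fun k => c * v k) @ \oo --> c * limn (series v).
  move=> cv; have E : series (fun k => c * v k) = (fun n => c * series v n).
    by apply/funext => n; rewrite /series /= mulr_sumr.
  by split=> //; rewrite E; exact: cvgMl_tmp.
have tF n N : `|limn (series (F n : nat -> R[i]^o)) - series (F n : nat -> R[i]^o) N|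
    <= (p n * (limn (series q) - series q N))%:C.
  have [E L] := seriesZ q (p n) cq.
  have [_ /(_ N)] := series_dominated (Fb n) (cvgP _ L).
  by rewrite (cvg_lim _ L) // E -mulrBr.
have Gb' n m : `|G m n| <= (q' n * p' m)%:C by rewrite mulrC.
have tG n N : `|limn (series (G ^~ n : nat -> R[i]^o))
                - series (G ^~ n : nat -> R[i]^o) N|
    <= (q' n * (limn (series p') - series p' N))%:C.
  have [E L] := seriesZ p' (q' n) cp'.
  have [_ /(_ N)] := series_dominated (Gb' n) (cvgP _ L).
  by rewrite (cvg_lim _ L) // E -mulrBr.
apply: (@cvgn_close _ (fun N => series a N * series b N)
  (fun N => series p N * (limn (series q) - series q N)
          + series q' N * (limn (series p') - series p' N))).
- move=> N.
  (* The sum of [G] over the square is taken with its indices exchanged, so that row [n] of [F]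
     meets column [n] of [G]. *)
  have -> : series a N * series b N
      = \sum_(0 <= n < N) (\sum_(0 <= m < N) F n m + \sum_(0 <= m < N) G m n).
    rewrite big_split /= [X in _ + X]exchange_big /= -big_split /=.
    rewrite [LHS]mulr_suml; apply: eq_bigr => n _.
    rewrite -big_split /= [LHS]mulr_sumr; apply: eq_bigr => m _.
    by rewrite FG.
  rewrite [X in X - _]/series /= -sumrB.
  rewrite (le_trans (ler_norm_sum _ _ _))// rmorphD /=.
  rewrite {1}/series [in X in _ + X]/series /= !mulr_suml !rmorph_sum -big_split /=.
  apply: ler_sum => n _; rewrite opprD addrACA (le_trans (ler_normD _ _))//.
  apply: lerD; [exact: tF|exact: tG].
- rewrite -[0]addr0 -[X in X + _](mulr0 (limn (series p))).
  rewrite -[X in _ + X](mulr0 (limn (series q'))).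
  apply: cvgD; apply: cvgM => //.
  + by rewrite -(subrr (limn (series q))); apply: cvgB => //; exact: cvg_cst.
  + by rewrite -(subrr (limn (series p'))); apply: cvgB => //; exact: cvg_cst.
- exact (@cvgn_regM R[i] _ _ _ _ ca cb).
Qed.

End ComplexSeries.

(** * Summability of the coefficients against [1/k^2] *)

Section Summability.
Context {R : realType}.

(* Telescoping: [s / k.+2 ^ (1 + s) <= 1 / k.+1 ^ s - 1 / k.+2 ^ s]. *)
Lemma cvgn_series_powR (s : R) : 0 < s ->
  cvgn (series (fun k => k.+1%:R `^ (- (1 + s)))).
Proof.
move=> s0; set u := fun k : nat => _.
have ndu : nondecreasing_seq (series u).
  by apply: nondecreasing_series => k _ _; exact: powR_ge0.
have step n : u n.+1 <= s^-1 * (n.+1%:R `^ (- s) - n.+2%:R `^ (- s)).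
  set N : R := n.+2%:R.
  have N0 : 0 < N by rewrite ltr0n.
  have -> : u n.+1 = s^-1 * (N `^ (- s) * (s / N)).
    rewrite /u -/N; have -> : - (1 + s) = - s + - 1 by ring.
    rewrite powRD ?(gt_eqF N0) ?implybT // [N `^ (- 1)]powRN powRr1 1?ltW //.
    by field; rewrite !gt_eqF.
  (* What remains is [N^(-s) (1 + s/N) <= (N-1)^(-s)]. It follows from [1 + t <= exp t] at
     [t = -1/N], which gives [lnM], and at [t = s/N]. *)
  rewrite ler_pM2l ?invr_gt0 // lerBrDl -[X in X + _]mulr1 -mulrDr.
  have M0 : 0 < n.+1%:R :> R by rewrite ltr0n.
  have lnM : ln n.+1%:R <= ln N - N^-1.
    rewrite -ler_expR expRD !lnK ?posrE // -ler_pdivrMl //.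
    apply: le_trans (expR_ge1Dx _); rewrite {1}/N [in X in _ <= X]/N.
    have -> : n.+1%:R = N - 1 by rewrite /N -[in RHS]natr1 addrK.
    by rewrite mulrBr mulVf ?gt_eqF // mulr1.
  rewrite /powR !gt_eqF //.
  apply: (@le_trans _ _ (expR (- s * ln N) * expR (s / N))).
    by rewrite ler_pM2l ?expR_gt0 // expR_ge1Dx.
  rewrite -expRD ler_expR !mulNr.
  by rewrite addrC -opprB lerN2 -mulrBr ler_pM2l.
apply: nondecreasing_is_cvgn => //; exists (1 + s^-1) => _ [n _ <-].
apply: le_trans (ndu _ _ (leqnSn n)) _.
have : series u n.+1 <= 1 + s^-1 * (1 - n.+1%:R `^ (- s)).
  elim: n => [|n IH].
    by rewrite /series /= big_nat1 /u !powR1 subrr mulr0 addr0.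
  rewrite seriesSr; apply: le_trans (lerD IH (step n)) _.
  by rewrite -addrA -mulrDr addrA subrK.
move=> /le_trans; apply; rewrite lerD2l ger_pMr ?invr_gt0 // gerBl powR_ge0.
Qed.

(** The finitely many early values are absorbed into the constant. This turns asymptotic estimates
    into bounds for all indices. *)
Lemma near_le1_bounded (f : nat -> R) : (\forall n \near \oo, f n <= 1) ->
  exists2 C, 0 <= C & forall n, f n <= C.
Proof.
move=> [N _ HN]; exists (1 + \sum_(k < N) `|f k|).
  by rewrite addr_ge0 // sumr_ge0.
move=> n; have [Nn|nN] := leqP N n.
  by apply: le_trans (HN n Nn) _; rewrite lerDl sumr_ge0.
rewrite (bigD1 (Ordinal nN)) //= addrCA (le_trans (ler_norm _)) // lerDl.
by rewrite addr_ge0 // sumr_ge0.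
Qed.

(** Norms on [R[i]] take values in [R[i]]; [complex.Re] moves them to [R], where the dominating
    series live. *)
Lemma Re_normC (z : R[i]) : (complex.Re `|z|)%:C = `|z|.
Proof. by rewrite normc_def. Qed.

Lemma Re_normCM (z w : R[i]) :
  (complex.Re `|z| * complex.Re `|w|)%:C = `|z| * `|w|.
Proof.
exact: etrans (rmorphM _ _ _) (congr2 *%R (Re_normC z) (Re_normC w)).
Qed.

Lemma Re_normC_ge0 (z : R[i]) : 0 <= complex.Re `|z|.
Proof. by rewrite -ler0c Re_normC. Qed.

(** The terms are at most [C k^(c-2)], and [c - 2 = -(1 + s)] with [s = 1 - c > 0]. *)
Lemma littleo_pow_summable (A : int -> R[i]) (c : R) :
  c < 1 -> littleo_pow A c ->
  cvgn (series (fun k => complex.Re `|A k.+1%:Z| / k.+1%:R ^+ 2)).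
Proof.
move=> c1 [/eqoP/(_ _ ltr01) o1 _].
have [C C0 HC] : exists2 C, 0 <= C &
    forall n : nat, complex.Re `|A n%:Z| / n%:R `^ c <= C.
  apply: near_le1_bounded; near=> n.
  rewrite ler_pdivrMr ?powR_gt0 ?ltr0n //; last by near: n; exists 1%N.
  rewrite mul1r -lecR Re_normC.
  have : `|A n%:Z : R[i]^o| <= 1 * `|(n%:R `^ c)%:C : R[i]^o| by near: n.
  by rewrite mul1r [X in _ <= X -> _]normc_real (ger0_norm (powR_ge0 _ _)).
have s0 : 0 < 1 - c by rewrite subr_gt0.
have : cvgn (series (fun k => C * k.+1%:R `^ (- (1 + (1 - c))))).
  exact: (is_cvg_seriesZ (cvgn_series_powR s0)).
apply: series_le_cvg.
- by move=> n; rewrite divr_ge0 // Re_normC_ge0.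
- by move=> n; rewrite mulr_ge0 // powR_ge0.
move=> n; have n0 : 0 < n.+1%:R :> R by rewrite ltr0n.
have -> : - (1 + (1 - c)) = c - 2%:R by ring.
rewrite powRB ?(gt_eqF n0) ?implybT // powR_mulrn ?(ltW n0) // mulrA.
rewrite ler_pM2r ?invr_gt0 ?exprn_gt0 //.
by have := HC n.+1; rewrite ler_pdivrMr ?powR_gt0.
Unshelve. all: by end_near. Qed.

Lemma sqr_sub_nat_bound (x : R) : x \isn't a Num.int ->
  exists2 K, 0 <= K & forall k : nat,
    `|(k.+1%:R ^+ 2 - x ^+ 2)^-1| <= K / k.+1%:R ^+ 2.
Proof.
move=> hx.
(* The division by 2 makes the eventual bound 1: for [n >= 2 x^2 + 1], [n^2 >= n] yields
   [n^2 <= 2 (n^2 - x^2)]. *)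
have [K K0 HK] : exists2 K, 0 <= K & forall n : nat,
    n%:R ^+ 2 * `|(n%:R ^+ 2 - x ^+ 2)^-1| / 2 <= K.
  apply: near_le1_bounded; near=> n.
  have n1 : 1 <= n%:R :> R by rewrite ler1n; near: n; exists 1%N.
  have nx : 2 * x ^+ 2 + 1 <= n%:R by near: n; exact: nbhs_infty_ger.
  have nn : n%:R <= n%:R ^+ 2 :> R by rewrite expr2 ler_peMr //; lra.
  have d0 : 0 < n%:R ^+ 2 - x ^+ 2 :> R by have := sqr_ge0 x; lra.
  rewrite ger0_norm ?invr_ge0 ?(ltW d0) // -mulrA -invfM ler_pdivrMr ?mulr_gt0 //.
  by have := sqr_ge0 x; lra.
exists (K * 2); first by rewrite mulr_ge0.
move=> k; rewrite ler_pdivlMr ?exprn_gt0 ?ltr0n // mulrC -ler_pdivrMr //.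
Unshelve. all: by end_near. Qed.

End Summability.

(** * Series expansions of [cot_seq] and [coth_seq] at real arguments *)

Section Cotangent.
Context {R : realType}.
Implicit Types (A B : int -> R[i]).

(* The paper's sums start at [k = 1], [series] at [k = 0], whence the shift. *)
Definition term1 A (f : nat -> R) (k : nat) : R[i]^o := A k.+1%:Z * (f k.+1)%:C.

Lemma psum1E (u : nat -> R[i]) :
  psum1 u = series (fun k => u k.+1 : R[i]^o).
Proof. by apply/funext => n; rewrite /psum1 /series /= big_add1. Qed.

Lemma sum1E A (g : nat -> R[i]) f : (forall k, g k = A k%:Z * (f k)%:C) ->
  sum1 g = limn (series (term1 A f)).
Proof.
move=> gE; rewrite /sum1 psum1E.
by have -> : (fun k => g k.+1) = term1 A f by apply/funext => k; rewrite gE.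
Qed.

Lemma cot_seqE A (x : R) : cot_seq A (pi * x)%:C =
  (A 0 / x%:C
   - 2 * x%:C * limn (series (term1 A (fun k => (k%:R ^+ 2 - x ^+ 2)^-1)))) / pi%:C.
Proof.
have pi0 : pi%:C != 0 :> R[i] by rewrite fmorph_eq0 gt_eqF ?pi_gt0.
rewrite /cot_seq rmorphM mulrAC mulfV // mul1r /picot.
rewrite (@sum1E A _ (fun k => (k%:R ^+ 2 - x ^+ 2)^-1)) // => k.
by rewrite fmorphV rmorphB !rmorphXn rmorph_nat.
Qed.

(** Since [(i t)^2 = -t^2], the denominators become [k^2 + t^2]. The outer [i] cancels the one under
    [B 0] and flips the sign of the sum. *)
Lemma coth_seqE B (t : R) : t != 0 -> coth_seq B (pi * t)%:C =
  (B 0 / t%:C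
   + 2 * t%:C * limn (series (term1 B (fun k => (k%:R ^+ 2 + t ^+ 2)^-1)))) / pi%:C.
Proof.
move=> t0; have pi0 : pi%:C != 0 :> R[i] by rewrite fmorph_eq0 gt_eqF ?pi_gt0.
have t0' : t%:C != 0 :> R[i] by rewrite fmorph_eq0.
have ii : 'i%C * 'i%C = -1 :> R[i] by rewrite -expr2 sqr_i.
have i0 : 'i%C != 0 :> R[i] by rewrite complexiE neq0Ci.
have piK : 'i%C * (pi * t)%:C / pi%:C = 'i%C * t%:C.
  by rewrite rmorphM mulrCA mulrAC mulfV // mul1r.
rewrite /coth_seq /cot_seq piK /picot mulrA.
congr (_ / _); rewrite (@sum1E B _ (fun k => (k%:R ^+ 2 + t ^+ 2)^-1)); last first.
  move=> k; rewrite exprMn sqr_i mulN1r opprK.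
  by rewrite fmorphV rmorphD !rmorphXn rmorph_nat.
rewrite mulrBr; congr (_ + _); first by field; rewrite t0' i0.
set l := limn _.
have -> : 'i%C * (2 * ('i%C * t%:C) * l) = ('i%C * 'i%C) * (2 * t%:C * l) by ring.
by rewrite ii mulN1r opprK.
Qed.

Lemma term1_le A f (C : R) k : `|f k.+1| <= C / k.+1%:R ^+ 2 ->
  `|term1 A f k| <= (C * (complex.Re `|A k.+1%:Z| / k.+1%:R ^+ 2))%:C.
Proof.
move=> fC; rewrite normrM normc_real -Re_normC -rmorphM lecR.
by rewrite mulrCA ler_wpM2l // Re_normC_ge0.
Qed.

(** The series of norms provides the dominating sequences for [cvgn_diag_series]. *)
Lemma term1_summable A f (C : R) :
  cvgn (series (fun k => complex.Re `|A k.+1%:Z| / k.+1%:R ^+ 2)) ->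
  (forall k, `|f k.+1| <= C / k.+1%:R ^+ 2) ->
  cvgn (series (term1 A f)) /\ cvgn (series (fun k => complex.Re `|term1 A f k|)).
Proof.
move=> cA fC.
have cCA : cvgn (series
    (fun k => C * (complex.Re `|A k.+1%:Z| / k.+1%:R ^+ 2))).
  exact: (is_cvg_seriesZ cA).
have le k := term1_le A (fC k).
split; first by have [] := series_dominated le cCA.
apply: series_le_cvg cCA => k; first exact: Re_normC_ge0.
  by rewrite -ler0c; exact: le_trans (le k).
by rewrite -lecR Re_normC.
Qed.

End Cotangent.

(** * The embedding of the reals and the algebraic identities *)

Section RealComplexMorphism.
Context {R : realType}.
Implicit Types a b : R.

Lemma realcM a b : (a * b)%:C = a%:C * b%:C. Proof. exact: rmorphM. Qed.
Lemma realcD a b : (a + b)%:C = a%:C + b%:C. Proof. exact: rmorphD. Qed.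
Lemma realcB a b : (a - b)%:C = a%:C - b%:C. Proof. exact: rmorphB. Qed.
Lemma realcV a : a^-1%:C = a%:C^-1. Proof. exact: fmorphV. Qed.
Lemma realcX a n : (a ^+ n)%:C = a%:C ^+ n. Proof. exact: rmorphXn. Qed.

End RealComplexMorphism.

(** With [D = (n y)^2 + (m x)^2], the left side is [x^2/(t D) + y^2/(s D)] for [t = n^2 - x^2] and
    [s = m^2 + y^2], and [x^2 s + y^2 t = D]. *)
Lemma add_inv_sqr_mul (R : realType) (x y n m : R) :
  x != 0 -> y != 0 -> 0 < m -> n ^+ 2 - x ^+ 2 != 0 ->
  (n ^+ 2 - x ^+ 2)^-1 * (m ^+ 2 + (n * y / x) ^+ 2)^-1
  + (m ^+ 2 + y ^+ 2)^-1 * (n ^+ 2 + (m * x / y) ^+ 2)^-1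
  = (n ^+ 2 - x ^+ 2)^-1 * (m ^+ 2 + y ^+ 2)^-1.
Proof.
move=> x0 y0 m0 nx.
have x2 : 0 < x ^+ 2 by rewrite exprn_even_gt0.
have m2 : 0 < m ^+ 2 by rewrite exprn_gt0.
have d1 : m ^+ 2 + y ^+ 2 != 0 by rewrite gt_eqF // ltr_wpDr // sqr_ge0.
have d2 : (n * y) ^+ 2 + (m * x) ^+ 2 != 0.
  by rewrite gt_eqF // ltr_wpDl ?sqr_ge0 // exprMn mulr_gt0.
by field; rewrite x0 y0 nx d1 d2.
Qed.

(** [LA] and [LB] stand for the inner series of the two [coth] values. The right side is a linear
    combination of pieces whose sums over [N] converge separately. *)
Lemma summand_identity (K : numFieldType) (X Y N P An Bn A0 B0 LA LB : K) :
  X != 0 -> Y != 0 -> N != 0 -> P != 0 ->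
  N ^+ 2 - X ^+ 2 != 0 -> N ^+ 2 + Y ^+ 2 != 0 ->
  X ^+ 2 * An * ((B0 / (N * Y / X) + 2 * (N * Y / X) * LB) / P)
    / (N * (N ^+ 2 - X ^+ 2))
  + Y ^+ 2 * Bn * ((A0 / (N * X / Y) + 2 * (N * X / Y) * LA) / P)
    / (N * (N ^+ 2 + Y ^+ 2))
  = (2 * P * X * Y)^-1 *
    (2 * B0 * X ^+ 2 * (An * (N ^+ 2 - X ^+ 2)^-1 - An * (N ^+ 2)^-1)
     + 2 * A0 * Y ^+ 2 * (Bn * (N ^+ 2)^-1 - Bn * (N ^+ 2 + Y ^+ 2)^-1)
     + 4 * X ^+ 2 * Y ^+ 2 * (An * (N ^+ 2 - X ^+ 2)^-1 * LB
                             + Bn * (N ^+ 2 + Y ^+ 2)^-1 * LA)).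
Proof.
move=> X0 Y0 N0 P0 NX NY; field.
by rewrite X0 Y0 N0 P0 NX NY.
Qed.

(** On the right, the [dA] and [dB] terms cancel, leaving the expanded product of the two
    expansions. *)
Lemma product_identity (K : numFieldType) (X Y P A0 B0 a b dA dB : K) :
  X != 0 -> Y != 0 -> P != 0 ->
  P ^+ 2 * X * Y * ((A0 / X - 2 * X * a) / P) * ((B0 / Y + 2 * Y * b) / P)
  = A0 * B0 + 2 * A0 * dB * Y ^+ 2 - 2 * B0 * dA * X ^+ 2
    - 2 * P * X * Y * ((2 * P * X * Y)^-1 *
      (2 * B0 * X ^+ 2 * (a - dA) + 2 * A0 * Y ^+ 2 * (dB - b)
       + 4 * X ^+ 2 * Y ^+ 2 * (a * b))).
Proof. by move=> X0 Y0 P0; field; rewrite X0 Y0 P0. Qed.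

Unset Implicit Arguments.

(** * Assembly of the product formula *)

Theorem theorem5p6 (R : realType) (A B : int -> R[i]) (x y : R)
  (hA : exists2 c : R, c < 1 & littleo_pow A c)
  (hB : exists2 c : R, c < 1 & littleo_pow B c)
  (hx0 : x != 0) (hy0 : y != 0) (hx : x \isn't a Num.int) :
  let u := fun n : nat =>
    (x ^+ 2)%:C * A n%:Z * coth_seq B (pi * n%:R * y / x)%:C
      / (n%:R * (n%:R ^+ 2 - x ^+ 2))%:C
    + (y ^+ 2)%:C * B n%:Z * coth_seq A (pi * n%:R * x / y)%:C
      / (n%:R * (n%:R ^+ 2 + y ^+ 2))%:C in
  cvgn (psum1 u) /\
  (pi ^+ 2 * x * y)%:C * cot_seq A (pi * x)%:C * coth_seq B (pi * y)%:C
  = A 0 * B 0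
    + 2 * A 0 * Dseq B 2 * (y ^+ 2)%:C
    - 2 * B 0 * Dseq A 2 * (x ^+ 2)%:C
    - (2 * pi * x * y)%:C * sum1 u.

Proof.
case: hA => cA cA1 /(littleo_pow_summable cA1) sA.
case: hB => cB cB1 /(littleo_pow_summable cB1) sB.
have [K K0 HK] := sqr_sub_nat_bound hx.
pose fx (k : nat) : R := (k%:R ^+ 2 - x ^+ 2)^-1.
pose fp (t : R) (k : nat) : R := (k%:R ^+ 2 + t ^+ 2)^-1.
pose f2 (k : nat) : R := (k%:R ^+ 2)^-1.
have sq0 (k : nat) : 0 < k.+1%:R ^+ 2 :> R by rewrite exprn_gt0 ?ltr0n.
have f2le k : `|f2 k.+1| <= 1 / k.+1%:R ^+ 2.
  by rewrite mul1r ger0_norm // invr_ge0 ltW.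
have fple t k : `|fp t k.+1| <= 1 / k.+1%:R ^+ 2.
  have p0 : 0 < k.+1%:R ^+ 2 + t ^+ 2 by rewrite ltr_wpDr ?sqr_ge0.
  by rewrite mul1r ger0_norm ?invr_ge0 ?(ltW p0) // lef_pV2 ?posrE // lerDl sqr_ge0.
have fxle k : `|fx k.+1| <= K / k.+1%:R ^+ 2 := HK k.
have [cal nal] := term1_summable sA fxle.
have [ca2 na2] := term1_summable sA f2le.
have [cb2 nb2] := term1_summable sB f2le.
have [cbe nbe] := term1_summable sB (fple y).
pose al := term1 A fx; pose be := term1 B (fp y).
pose a2 := term1 A f2; pose b2 := term1 B f2.
pose LB n : R[i] := limn (series (term1 B (fp (n.+1%:R * y / x)))).
pose LA m : R[i] := limn (series (term1 A (fp (m.+1%:R * x / y)))).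
have cLB n := (term1_summable sB (fple (n.+1%:R * y / x))).1.
have cLA m := (term1_summable sA (fple (m.+1%:R * x / y))).1.
(* Row [n] of [F] and column [m] of [G] sum, up to constants, to the series parts of the two [coth]
   contributions. *)
pose F n m : R[i] := al n * term1 B (fp (n.+1%:R * y / x)) m.
pose G n m : R[i] := be m * term1 A (fp (m.+1%:R * x / y)) n.
have limF n : limn (series (F n : nat -> R[i]^o)) = al n * LB n.
  exact (@cvgn_reglim R[i] _ _ (@cvgn_regseriesZ R[i] (al n) _ _ (cLB n))).
have limG m : limn (series (G ^~ m : nat -> R[i]^o)) = be m * LA m.
  exact (@cvgn_reglim R[i] _ _ (@cvgn_regseriesZ R[i] (be m) _ _ (cLA m))).
have x2n k : k.+1%:R ^+ 2 - x ^+ 2 != 0 :> R.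
  rewrite subr_eq0 eqf_sqr; apply/norP; split; apply: contraNneq hx.
    by move=> <-; rewrite natr_int.
  by move=> e; rewrite -[x]opprK -e rpredN natr_int.
have normterm (C : int -> R[i]) (f : nat -> R) k : `|f k.+1| <= 1 / k.+1%:R ^+ 2 ->
    `|term1 C f k| <= `|term1 C f2 k|.
  move=> fk; rewrite !normrM ler_wpM2l // !normc_real lecR.
  by rewrite [`|f2 _|]ger0_norm ?invr_ge0 ?(ltW (sq0 k)) //; move: fk; rewrite mul1r.
have cFG : series (fun n => limn (series (F n : nat -> R[i]^o))
               + limn (series (G ^~ n : nat -> R[i]^o))) @ \oo -->
    ((limn (series al) : R[i]) * (limn (series be) : R[i]) : R[i]^o).
  (* By [normterm], dropping the square that couples the indices bounds [F n m] by [|al n| |b2 m|]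
     and [G n m] by [|a2 n| |be m|]. *)
  apply: (cvgn_diag_series _ _ _ _ _ nal nb2 na2 nbe cal cbe).
  - move=> n m; rewrite /F /G /al /be /term1.
    have := add_inv_sqr_mul hx0 hy0 (ltr0Sn R m) (x2n n).
    move/(congr1 (real_complex R)); rewrite rmorphD !rmorphM /fx /fp => E.
    transitivity (A n.+1%:Z * B m.+1%:Z * (fx n.+1 * fp y m.+1)%:C).
      by rewrite rmorphM -E; ring.
    by rewrite rmorphM; ring.
  - move=> n m; cbv beta; rewrite Re_normCM normrM ler_wpM2l //.
    exact: normterm.
  - move=> n m; cbv beta; rewrite Re_normCM normrM mulrC ler_wpM2r //.
    exact: normterm.
  - by move=> n; exact: Re_normC_ge0.
  - by move=> n; exact: Re_normC_ge0.
pose X := x%:C; pose Y := y%:C; pose P : R[i] := pi%:C.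
have X0 : X != 0 by rewrite fmorph_eq0.
have Y0 : Y != 0 by rewrite fmorph_eq0.
have P0 : P != 0 by rewrite fmorph_eq0 gt_eqF ?pi_gt0.
(* [w n] is the bracket of [summand_identity] at index [n.+1], and [W] is the bracket of
   [product_identity]. *)
pose w n : R[i] := 2 * B 0 * X ^+ 2 * (al n - a2 n)
  + 2 * A 0 * Y ^+ 2 * (b2 n - be n)
  + 4 * X ^+ 2 * Y ^+ 2 * (limn (series (F n : nat -> R[i]^o))
               + limn (series (G ^~ n : nat -> R[i]^o))).
pose W : R[i] := 2 * B 0 * X ^+ 2 * (limn (series al) - limn (series a2))
  + 2 * A 0 * Y ^+ 2 * (limn (series b2) - limn (series be))
  + 4 * X ^+ 2 * Y ^+ 2 * (limn (series al) * limn (series be)).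
have cw : series (fun n => (2 * P * X * Y)^-1 * w n : R[i]^o) @ \oo -->
    ((2 * P * X * Y)^-1 * W : R[i]^o).
  have h1 := @cvgn_regseriesZ R[i] (2 * B 0 * X ^+ 2) _ _
    (@cvgn_regseriesB R[i] _ _ _ _ cal ca2).
  have h2 := @cvgn_regseriesZ R[i] (2 * A 0 * Y ^+ 2) _ _
    (@cvgn_regseriesB R[i] _ _ _ _ cb2 cbe).
  have h3 := @cvgn_regseriesZ R[i] (4 * X ^+ 2 * Y ^+ 2) _ _ cFG.
  exact (@cvgn_regseriesZ R[i] (2 * P * X * Y)^-1 _ _
    (@cvgn_regseriesD R[i] _ _ _ _ (@cvgn_regseriesD R[i] _ _ _ _ h1 h2) h3)).
move=> u.
have uE : psum1 u = series (fun n => (2 * P * X * Y)^-1 * w n : R[i]^o).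
  rewrite psum1E; congr series; apply/funext => k.
  rewrite /w limF limG /u.
  have k0 : k.+1%:R != 0 :> R by rewrite pnatr_eq0.
  (* Reassociation to the form [pi * t] expected by [coth_seqE]. *)
  have -> : pi * k.+1%:R * y / x = pi * (k.+1%:R * y / x) by rewrite !mulrA.
  have -> : pi * k.+1%:R * x / y = pi * (k.+1%:R * x / y) by rewrite !mulrA.
  rewrite !coth_seqE ?mulf_neq0 ?invr_neq0 // -/(fp _) -/(LB k) -/(LA k).
  have NX : (k.+1%:R : R)%:C ^+ 2 - X ^+ 2 != 0.
    by have := x2n k; rewrite -(fmorph_eq0 (real_complex R)) rmorphB !rmorphXn.
  have NY : (k.+1%:R : R)%:C ^+ 2 + Y ^+ 2 != 0.
    have : k.+1%:R ^+ 2 + y ^+ 2 != 0 by rewrite gt_eqF // ltr_wpDr ?sqr_ge0.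
    by rewrite -(fmorph_eq0 (real_complex R)) rmorphD !rmorphXn.
  have N0 : (k.+1%:R : R)%:C != 0 by rewrite fmorph_eq0.
  have := summand_identity (A k.+1%:Z) (B k.+1%:Z) (A 0) (B 0) (LA k) (LB k)
    X0 Y0 N0 P0 NX NY.
  rewrite /al /be /a2 /b2 /term1 /fx /fp /f2 -/X.
  by rewrite -/P !realcX !realcM !realcV realcB realcD !realcX.
split; first by rewrite uE; apply/cvg_ex; eexists; exact: cw.
have -> : sum1 u = (2 * P * X * Y)^-1 * W.
  by rewrite /sum1 uE; exact (@cvgn_reglim R[i] _ _ cw).
have dA : Dseq A 2 = limn (series a2).
  by apply: sum1E => k; rewrite /f2 fmorphV rmorphXn rmorph_nat.
have dB : Dseq B 2 = limn (series b2).
  by apply: sum1E => k; rewrite /f2 fmorphV rmorphXn rmorph_nat.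
rewrite cot_seqE coth_seqE // dA dB -/fx -/(fp y) -/al -/be /W.
rewrite 2!realcM !realcX 3!realcM (rmorph_nat (real_complex R)) -/X -/Y -/P.
exact: product_identity.
Qed.
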